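(* Let $x>0$, let $n\ge0$ be an integer, and let $\kappa\in\mathbb{R}$. Then $$\mathrm{wi}_{\kappa+n,\kappa-1/2}(x)=(-1)^n(2\kappa)_n\,2^{\kappa}\sum_{m=0}^{n}\binom{n}{m}\frac{(-2)^m}{(2\kappa)_m}\,\Gamma\left(\kappa+m,\frac x2\right),$$ where, when $2\kappa\in\{0,-1,-2,\ldots\}$, the quotient $(2\kappa)_n/(2\kappa)_m$ is understood as $(2\kappa+m)_{n-m}=\prod_{j=m}^{n-1}(2\kappa+j)$.
   Context: The integral Whittaker function $\mathrm{wi}$ is $\mathrm{wi}_{\kappa,\mu}(x)=\int_x^\infty\frac{\mathrm{W}_{\kappa,\mu}(t)}{t}\,dt$, where for $t>0$ the Whittaker function is $\mathrm{W}_{\kappa,\mu}(t)=e^{-t/2}t^{\mu+1/2}\,\mathrm{U}\left(\frac12+\mu-\kappa,1+2\mu,t\right)$ with $\mathrm{U}$ the Tricomi confluent hypergeometric function. $(\alpha)_n=\Gamma(\alpha+n)/\Gamma(\alpha)=\prod_{j=0}^{n-1}(\alpha+j)$ is the Pochhammer symbol, and $\Gamma(\nu,z)=\int_z^\infty t^{\nu-1}e^{-t}\,dt$ is the upper incomplete gamma function. *)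

(* Defs.v *)
From Stdlib Require Import Reals ClassicalEpsilon.
From Coquelicot Require Import Coquelicot.
Open Scope R_scope.

Fixpoint pochhammer (a : R) (n : nat) : R :=
  match n with
  | O => 1
  | S k => pochhammer a k * (a + INR k)
  end.

(* On the positive half-line, U(a,b,.) is the solution of Kummer's equation
   t u'' + (b - t) u' - a u = 0 with u(t) ~ t^(-a) as t -> +oo.  This determines
   u on (0,+oo) for all real a, b: Kummer's equation has a second solution
   growing like e^t t^(a-b), so the asymptotic condition excludes any multiple
   of it and fixes the remaining constant.
   [ex_derive u t] is not redundant: [Derive] is total, so [ex_derive_n u 2 t]
   does not by itself imply differentiability of [u]. *)
Definition is_tricomiU (a b : R) (u : R -> R) : Prop :=
  (forall t, 0 < t ->
     ex_derive u t /\ ex_derive_n u 2 t /\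
     t * Derive_n u 2 t + (b - t) * Derive u t - a * u t = 0) /\
  is_lim (fun t => u t / Rpower t (- a)) p_infty 1.

(* Values at t <= 0 are unspecified. *)
Definition tricomiU (a b : R) : R -> R :=
  epsilon (inhabits (fun _ : R => 0)) (is_tricomiU a b).

(* Meaningful for t > 0 only. *)
Definition whittakerW (kappa mu t : R) : R :=
  exp (- t / 2) * Rpower t (mu + 1 / 2)
    * tricomiU (1 / 2 + mu - kappa) (1 + 2 * mu) t.

Definition wi (kappa mu x : R) : R :=
  RInt_gen (fun t => whittakerW kappa mu t / t)
    (at_point x) (Rbar_locally p_infty).

Definition upper_gamma (nu z : R) : R :=
  RInt_gen (fun t => Rpower t (nu - 1) * exp (- t))
    (at_point z) (Rbar_locally p_infty).

(* Main.v *)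
(** Here U has first parameter [- n], so it should be the polynomial solution of
    Kummer's equation normalised by its leading term, and the formula is its
    termwise integral. The point is that U is only given by its equation and its
    asymptotics. For two such functions u and v, the Wronskian w is
    [C * exp t * t ^ (- b)] and [(v / u)' = w / u ^ 2]; if [C] were nonzero this
    would stay away from 0, while v / u tends to 1. So [C = 0], hence v = u near
    infinity, and backward uniqueness for the linear equation gives v = u on the
    whole half-line. *)

Require Import Defs.
From Stdlib Require Import Reals Lra Lia ClassicalEpsilon.
From Coquelicot Require Import Coquelicot.
Open Scope R_scope.

(** * Growth bounds and backward uniqueness for Kummer's equation *)

Lemma derive_ge_increment (f df : R -> R) (a b delta : R) :
  a <= b -> (forall t, a <= t <= b -> is_derive f t (df t)) ->
  (forall t, a <= t <= b -> delta <= df t) ->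
  delta * (b - a) <= f b - f a.
Proof.
intros Hab Hf Hdf.
destruct (MVT_gen f a b df) as [c [Hc ->]].
- intros t Ht; apply Hf; rewrite Rmin_left, Rmax_right in Ht by lra; lra.
- intros t Ht; rewrite Rmin_left, Rmax_right in Ht by lra.
  apply continuity_pt_filterlim, (ex_derive_continuous f t).
  exists (df t); apply Hf; lra.
- rewrite Rmin_left, Rmax_right in Hc by lra.
  apply Rmult_le_compat_r; [lra | auto].
Qed.

Lemma exp_le (x y : R) : x <= y -> exp x <= exp y.
Proof.
intros [H | ->]; [apply Rlt_le, exp_increasing, H | apply Rle_refl].
Qed.

(** If [p <= 0], the power is largest at [z]. If [p > 0], the inequality [1 + y <= exp y] at
    [y = ln (c / p * t)], multiplied by [p], bounds [p * ln t] by [c * t] plus a constant. *)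
Lemma Rpower_le_exp (p c z : R) :
  0 < c -> 0 < z ->
  exists M, 0 < M /\ forall t, z <= t -> Rpower t p <= M * exp (c * t).
Proof.
intros Hc Hz.
destruct (Rle_lt_dec p 0) as [Hp | Hp].
- exists (exp (p * ln z)); split; [apply exp_pos | intros t Ht].
  unfold Rpower; rewrite <- exp_plus; apply exp_le.
  assert (ln z <= ln t) by (apply ln_le; lra); nra.
- exists (exp (- p - p * ln (c / p))); split; [apply exp_pos | intros t Ht].
  unfold Rpower; rewrite <- exp_plus; apply exp_le.
  assert (0 < c / p) by (apply Rdiv_lt_0_compat; lra).
  assert (Hl := exp_ineq1_le (ln (c / p * t))).
  rewrite exp_ln in Hl by nra.
  rewrite ln_mult in Hl by lra.
  apply (Rmult_le_compat_l p) in Hl; [ | lra].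
  replace (p * (c / p * t)) with (c * t) in Hl by (field; lra).
  lra.
Qed.

(* Gronwall: with [K] large, [exp (K * t) * (d ^ 2 + d' ^ 2)] is nondecreasing
   on [[s, T]], and it vanishes at [T]. *)
Lemma kummer_zero_backwards (a b s T : R) (d d1 d2 : R -> R) :
  0 < s <= T ->
  (forall t, 0 < t -> is_derive d t (d1 t)) ->
  (forall t, 0 < t -> is_derive d1 t (d2 t)) ->
  (forall t, 0 < t -> t * d2 t + (b - t) * d1 t - a * d t = 0) ->
  d T = 0 -> d1 T = 0 -> d s = 0.
Proof.
intros Hs Hd Hd1 Hode HT HT1.
(* After [d2] is eliminated through the equation, [1 + Rabs a / s] absorbs the cross term in
   [d * d1] and [2 * (Rabs b / s + 1)] absorbs the term in [d1 ^ 2]; both bound the coefficients for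
   every [t >= s]. *)
pose (K := 1 + Rabs a / s + 2 * (Rabs b / s + 1)).
pose (E := fun t => (d t ^ 2 + d1 t ^ 2) * exp (K * t)).
pose (dE := fun t => (2 * d t * d1 t + 2 * d1 t * d2 t
                      + K * (d t ^ 2 + d1 t ^ 2)) * exp (K * t)).
assert (HE : 0 * (T - s) <= E T - E s).
{ apply derive_ge_increment with dE; [lra | | ].
  - intros t Ht.
    assert (D := Hd t ltac:(lra)); assert (D1 := Hd1 t ltac:(lra)).
    unfold E, dE; auto_derive.
    + split; [exists (d1 t); exact D | split; [exists (d2 t); exact D1 | auto]].
    + rewrite (is_derive_unique _ _ _ D : Derive (fun x => d x) t = _).
      rewrite (is_derive_unique _ _ _ D1 : Derive (fun x => d1 x) t = _).
      ring.
  - intros t Ht; unfold dE.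
    apply Rmult_le_pos; [ | apply Rlt_le, exp_pos].
    assert (Hd2 : d2 t = (1 - b / t) * d1 t + a / t * d t).
    { assert (H := Hode t ltac:(lra)).
      apply (Rmult_eq_reg_l t); [ | lra].
      replace (t * ((1 - b / t) * d1 t + a / t * d t))
        with ((t - b) * d1 t + a * d t) by (field; lra).
      lra. }
    rewrite Hd2.
    assert (Hinv : forall c, Rabs (c / t) <= Rabs c / s).
    { intros c; unfold Rdiv; rewrite Rabs_mult, Rabs_inv, (Rabs_pos_eq t) by lra.
      apply Rmult_le_compat_l; [apply Rabs_pos | apply Rinv_le_contravar; lra]. }
    assert (Ha := proj1 (Rabs_le_between _ _) (Hinv a)).
    assert (Hb := proj1 (Rabs_le_between _ _) (Hinv b)).
    unfold K.
    set (A := Rabs a / s) in *; set (B := Rabs b / s) in *.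
    set (al := a / t) in *; set (be := b / t) in *.
    set (p := d t) in *; set (q := d1 t) in *.
    assert (0 <= (1 + A) * (p ^ 2 + q ^ 2) + 2 * p * q * (1 + al)).
    (* The claimed quadratic form is half the sum of these two nonnegative terms. *)
    { assert (0 <= (A - al) * (p - q) ^ 2)
        by (apply Rmult_le_pos; [lra | apply pow2_ge_0]).
      assert (0 <= (2 + A + al) * (p + q) ^ 2)
        by (apply Rmult_le_pos; [lra | apply pow2_ge_0]).
      nra. }
    assert (0 <= 2 * (B + 1) * p ^ 2)
      by (apply Rmult_le_pos; [lra | apply pow2_ge_0]).
    assert (0 <= 2 * (B + 1 + (1 - be)) * q ^ 2)
      by (apply Rmult_le_pos; [lra | apply pow2_ge_0]).
    nra. }
unfold E in HE; rewrite HT, HT1 in HE.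
assert (He := exp_pos (K * s)).
assert (H2 := pow2_ge_0 (d s)); assert (H3 := pow2_ge_0 (d1 s)).
assert (d s ^ 2 + d1 s ^ 2 <= 0) by nra.
nra.
Qed.

(** * Wronskians and uniqueness of the solution asymptotic to [t ^ (- a)] *)

Lemma is_tricomiU_derive (a b : R) (u : R -> R) :
  is_tricomiU a b u ->
  forall t, 0 < t ->
    is_derive u t (Derive u t) /\ is_derive (Derive u) t (Derive_n u 2 t).
Proof.
intros [Hu _] t Ht; destruct (Hu t Ht) as [H1 [H2 _]].
split; apply Derive_correct; [exact H1 | exact H2].
Qed.

Definition wronskian (u v : R -> R) (t : R) : R := u t * Derive v t - Derive u t * v t.

(** Abel's identity: the equation gives [w' = (1 - b / t) * w], so [w * t ^ b * exp (- t)] is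
    constant and equals its value at 1. *)
Lemma kummer_wronskian (a b : R) (u v : R -> R) (t : R) :
  is_tricomiU a b u -> is_tricomiU a b v -> 0 < t ->
  wronskian u v t = wronskian u v 1 * exp (- 1) * Rpower t (- b) * exp t.
Proof.
intros Hu Hv Ht.
pose (h := fun t => wronskian u v t * (Rpower t b * exp (- t))).
assert (Hh : forall s, 0 < s -> is_derive h s 0).
{ intros s Hs.
  destruct (is_tricomiU_derive _ _ _ Hu s Hs) as [U1 U2].
  destruct (is_tricomiU_derive _ _ _ Hv s Hs) as [V1 V2].
  destruct Hu as [Hu _]; destruct (Hu s Hs) as [_ [_ Eu]].
  destruct Hv as [Hv _]; destruct (Hv s Hs) as [_ [_ Ev]].
  unfold h, wronskian, Rpower; auto_derive.
  - repeat split; try assumption; eexists; eassumption.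
  - rewrite (is_derive_unique _ _ _ U1 : Derive (fun x => u x) s = _).
    rewrite (is_derive_unique _ _ _ U2 : Derive (fun x => Derive u x) s = _).
    rewrite (is_derive_unique _ _ _ V2 : Derive (fun x => Derive v x) s = _).
    apply (Rmult_eq_reg_l s); [ | lra].
    set (u0 := u s) in *; set (v0 := v s) in *.
    set (u1 := Derive u s) in *; set (v1 := Derive v s) in *.
    set (u2 := Derive_n u 2 s) in *; set (v2 := Derive_n v 2 s) in *.
    set (g := exp (b * ln s)); set (e := exp (- s)).
    (* The derivative of [h], times [s], is [u] times the equation of [v] minus [v] times the
       equation of [u], up to the integrating factor. *)
    transitivity ((u0 * (s * v2 + (b - s) * v1 - a * v0)
                   - (s * u2 + (b - s) * u1 - a * u0) * v0) * g * e).
    + field; lra.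
    + rewrite Eu, Ev; ring. }
assert (E : h t = h 1).
{ destruct (Rtotal_order t 1) as [H | [H | H]].
  - apply (eq_is_derive h t 1); [ | lra]; intros s Hs; apply Hh; lra.
  - now rewrite H.
  - symmetry; apply (eq_is_derive h 1 t); [ | lra]; intros s Hs; apply Hh; lra. }
unfold h in E.
assert (R1 : Rpower 1 b = 1) by (unfold Rpower; rewrite ln_1, Rmult_0_r; apply exp_0).
rewrite R1, Rmult_1_l in E.
replace (wronskian u v 1 * exp (- 1)) with (wronskian u v t * (Rpower t b * exp (- t)))
  by exact E.
rewrite Rpower_Ropp, exp_Ropp.
field; split; apply Rgt_not_eq; apply exp_pos.
Qed.

(** Makes [u] positive far out, so that [v / u] can be formed there, and bounds this quotient. *)
Lemma is_tricomiU_eventually (a b : R) (u : R -> R) :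
  is_tricomiU a b u ->
  exists T, 0 < T /\ forall t, T <= t ->
    / 2 * Rpower t (- a) < u t < 2 * Rpower t (- a).
Proof.
intros [_ Hl].
destruct (proj2 (is_lim_spec _ _ _) Hl (mkposreal (/ 2) ltac:(lra))) as [M HM].
exists (Rmax (M + 1) 1); split; [assert (H := Rmax_r (M + 1) 1); lra | intros t Ht].
assert (H1 := Rmax_l (M + 1) 1).
specialize (HM t ltac:(lra)); simpl in HM.
apply Rabs_lt_between in HM.
assert (Hp : 0 < Rpower t (- a)) by apply exp_pos.
replace (u t) with (u t / Rpower t (- a) * Rpower t (- a)) by (field; lra).
split; apply Rmult_lt_compat_r; lra.
Qed.

Lemma is_derive_quotient (a b : R) (u v : R -> R) (t : R) :
  is_tricomiU a b u -> is_tricomiU a b v -> 0 < t -> u t <> 0 ->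
  is_derive (fun s => v s / u s) t (wronskian u v t / u t ^ 2).
Proof.
intros Hu Hv Ht H0.
destruct (is_tricomiU_derive _ _ _ Hu t Ht) as [U1 _].
destruct (is_tricomiU_derive _ _ _ Hv t Ht) as [V1 _].
unfold wronskian; auto_derive.
- repeat split; try assumption; eexists; eassumption.
- rewrite (is_derive_unique _ _ _ U1 : Derive (fun x => u x) t = _).
  rewrite (is_derive_unique _ _ _ V1 : Derive (fun x => v x) t = _).
  field; assumption.
Qed.

(* Otherwise [(v / u)'] would stay above a positive constant, although [v / u]
   is bounded. *)
Lemma kummer_wronskian_nonpos (a b : R) (u v : R -> R) :
  is_tricomiU a b u -> is_tricomiU a b v -> wronskian u v 1 <= 0.
Proof.
intros Hu Hv.
destruct (Rle_lt_dec (wronskian u v 1) 0) as [| Hw]; [assumption | exfalso].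
destruct (is_tricomiU_eventually _ _ _ Hu) as [T1 [HT1 Bu]].
destruct (is_tricomiU_eventually _ _ _ Hv) as [T2 [HT2 Bv]].
pose (T := Rmax T1 T2).
assert (M1 : T1 <= T) by apply Rmax_l; assert (M2 : T2 <= T) by apply Rmax_r.
(* Since [u ^ 2 <= 4 * t ^ (- 2 * a)], the derivative [w / u ^ 2] is at least
   [C / 4 * exp t / t ^ (b - 2 * a)]. Bounding that power by [M * exp t] leaves the constant
   [delta = C / (4 * M)]. *)
destruct (Rpower_le_exp (b - 2 * a) 1 T ltac:(lra) ltac:(lra)) as [M [HM BM]].
pose (C := wronskian u v 1 * exp (- 1)).
assert (HC : 0 < C) by (apply Rmult_lt_0_compat; [lra | apply exp_pos]).
pose (delta := C / (4 * M)).
assert (Hdelta : 0 < delta) by (apply Rdiv_lt_0_compat; lra).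
assert (Hinc : forall S, T <= S -> delta * (S - T) <= v S / u S - v T / u T).
{ intros S HS.
  apply (derive_ge_increment (fun s => v s / u s) (fun s => wronskian u v s / u s ^ 2));
    [lra | | ].
  - intros t Ht; apply (is_derive_quotient a b); try assumption; [lra | ].
    destruct (Bu t ltac:(lra)); assert (0 < Rpower t (- a)) by apply exp_pos; lra.
  - intros t Ht.
    destruct (Bu t ltac:(lra)) as [B1 B2].
    assert (Pa : 0 < Rpower t (- a)) by apply exp_pos.
    assert (Pb : 0 < Rpower t (- b)) by apply exp_pos.
    assert (Pe := exp_pos t).
    assert (Hbound := BM t ltac:(lra)).
    rewrite Rmult_1_l in Hbound.
    assert (Hsq : u t ^ 2 <= 4 * Rpower t (- a) ^ 2) by nra.
    assert (Hpow : Rpower t (- a) ^ 2 = Rpower t (b - 2 * a) * Rpower t (- b)).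
    { rewrite <- Rpower_plus; simpl; rewrite Rmult_1_r, <- Rpower_plus; f_equal; ring. }
    assert (Hu2 : 0 < u t ^ 2) by (apply pow_lt; lra).
    rewrite (kummer_wronskian a b u v t Hu Hv ltac:(lra)); fold C.
    apply (Rmult_le_reg_r (u t ^ 2)); [assumption | ].
    replace (C * Rpower t (- b) * exp t / u t ^ 2 * u t ^ 2)
      with (C * Rpower t (- b) * exp t) by (field; lra).
    apply Rle_trans with (delta * (4 * ((M * exp t) * Rpower t (- b)))).
    + apply Rmult_le_compat_l; [lra | ].
      apply Rle_trans with (1 := Hsq); rewrite Hpow.
      apply Rmult_le_compat_l; [lra | apply Rmult_le_compat_r; lra].
    + unfold delta; apply Req_le; field; lra. }
assert (Bq : forall t, T <= t -> 0 < v t / u t < 4).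
{ intros t Ht; destruct (Bu t ltac:(lra)); destruct (Bv t ltac:(lra)).
  assert (Pa : 0 < Rpower t (- a)) by apply exp_pos.
  split; [apply Rdiv_lt_0_compat; lra | ].
  apply (Rmult_lt_reg_r (u t)); [lra | ].
  replace (v t / u t * u t) with (v t) by (field; lra); lra. }
(* Over an interval of length [4 / delta] the quotient would grow by at least 4, while its values
   lie strictly between 0 and 4. *)
assert (H4 : 0 < 4 / delta) by (apply Rdiv_lt_0_compat; lra).
assert (H := Hinc (T + 4 / delta) ltac:(lra)).
replace (delta * (T + 4 / delta - T)) with 4 in H by (field; lra).
assert (A1 := Bq T ltac:(lra)); assert (A2 := Bq (T + 4 / delta) ltac:(lra)); lra.
Qed.

Lemma is_tricomiU_unique (a b : R) (u v : R -> R) :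
  is_tricomiU a b u -> is_tricomiU a b v -> forall t, 0 < t -> u t = v t.
Proof.
intros Hu Hv t Ht.
assert (W0 : forall s, 0 < s -> wronskian u v s = 0).
{ intros s Hs; rewrite (kummer_wronskian a b u v s Hu Hv Hs).
  (* The Wronskian is antisymmetric, so the sign bound in both orders forces it to vanish. *)
  assert (H1 := kummer_wronskian_nonpos a b u v Hu Hv).
  assert (H2 := kummer_wronskian_nonpos a b v u Hv Hu).
  assert (H3 : wronskian v u 1 = - wronskian u v 1) by (unfold wronskian; ring).
  replace (wronskian u v 1) with 0 by lra; ring. }
destruct (is_tricomiU_eventually _ _ _ Hu) as [T [HT Bu]].
assert (Pos : forall s, T <= s -> 0 < u s).
{ intros s Hs; destruct (Bu s Hs); assert (0 < Rpower s (- a)) by apply exp_pos; lra. }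
pose (q := v T / u T).
assert (Hq : forall s, T < s -> v s / u s = q).
{ intros s Hs; symmetry; apply (eq_is_derive (fun s => v s / u s)); [ | assumption].
  intros r Hr; assert (Pr := Pos r ltac:(lra)).
  change (is_derive (fun s => v s / u s) r 0).
  replace 0 with (wronskian u v r / u r ^ 2).
  - apply (is_derive_quotient a b); try assumption; lra.
  - rewrite W0 by lra; field; lra. }
(* Both solutions have the same normalisation at infinity, so [q * (u / t ^ (- a))] tends both to
   [q] and to 1. *)
assert (q1 : q = 1).
{ destruct Hu as [_ Lu]; destruct Hv as [_ Lv].
  assert (L : is_lim (fun s => q * (u s / Rpower s (- a))) p_infty (q * 1)).
  { apply (is_lim_scal_l _ q p_infty 1); exact Lu. }
  assert (L' : is_lim (fun s => q * (u s / Rpower s (- a))) p_infty 1).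
  { apply (is_lim_ext_loc (fun s => v s / Rpower s (- a))); [ | exact Lv].
    exists T; intros s Hs; rewrite <- (Hq s Hs).
    assert (Pr := Pos s ltac:(lra)).
    field; split; [apply Rgt_not_eq, exp_pos | lra]. }
  apply is_lim_unique in L; apply is_lim_unique in L'; rewrite L in L'.
  injection L'; lra. }
assert (Huv : forall s, T < s -> v s = u s).
{ intros s Hs; assert (Pr := Pos s ltac:(lra)).
  replace (v s) with (v s / u s * u s) by (field; lra).
  rewrite (Hq s Hs), q1; ring. }
assert (Hd : v t - u t = 0).
{ pose (S := Rmax (T + 1) t).
  assert (S1 : T + 1 <= S) by apply Rmax_l; assert (S2 : t <= S) by apply Rmax_r.
  apply (kummer_zero_backwards a b t S (fun s => v s - u s)
           (fun s => Derive v s - Derive u s)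
           (fun s => Derive_n v 2 s - Derive_n u 2 s)); [lra | | | | | ].
  - intros s Hs; apply (is_derive_minus v u);
      [apply (is_tricomiU_derive a b v Hv s Hs) | apply (is_tricomiU_derive a b u Hu s Hs)].
  - intros s Hs; apply (is_derive_minus (Derive v) (Derive u));
      [apply (is_tricomiU_derive a b v Hv s Hs) | apply (is_tricomiU_derive a b u Hu s Hs)].
  - intros s Hs; destruct Hu as [Hu _]; destruct (Hu s Hs) as [_ [_ Eu]].
    destruct Hv as [Hv _]; destruct (Hv s Hs) as [_ [_ Ev]]; lra.
  - rewrite Huv by lra; ring.
  (* With [v S = u S > 0], the vanishing Wronskian at [S] makes the first derivatives agree there
     too. *)
  - assert (W := W0 S ltac:(lra)); unfold wronskian in W.
    rewrite (Huv S ltac:(lra)) in W.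
    assert (Pr := Pos S ltac:(lra)); nra. }
lra.
Qed.

(** * The polynomial solution for first parameter [- n] *)

Lemma pochhammer_add (a : R) (m k : nat) :
  pochhammer a (m + k) = pochhammer a m * pochhammer (a + INR m) k.
Proof.
induction k as [| k IH].
- rewrite Nat.add_0_r; simpl; ring.
- rewrite Nat.add_succ_r; simpl; rewrite IH, plus_INR; ring.
Qed.

Lemma pochhammer_neq_0 (a : R) (n : nat) :
  (forall j : nat, a <> - INR j) -> pochhammer a n <> 0.
Proof.
intros Ha; induction n as [| n IH]; simpl; [lra | ].
apply Rmult_integral_contrapositive_currified; [assumption | ].
intros H; apply (Ha n); lra.
Qed.

(** Coefficients of [(-1) ^ n * n!] times the generalised Laguerre polynomial of degree [n] and
    parameter [b - 1]. The shifted Pochhammer symbol stands for the quotient of those of lengths [n]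
    and [m] at [b], and makes sense also when [b] is a nonpositive integer. *)
Definition tricomi_coeff (b : R) (n m : nat) : R :=
  (-1) ^ n * (Binomial.C n m * (-1) ^ m * pochhammer (b + INR m) (n - m)).

Definition tricomi_poly (b : R) (n : nat) (t : R) : R :=
  sum_f_R0 (fun m => tricomi_coeff b n m * t ^ m) n.

(** This is Kummer's equation read at the power [t ^ m]; the product form allows [b + m = 0]. *)
Lemma tricomi_coeff_succ (b : R) (n m : nat) :
  (m < n)%nat ->
  INR (S m) * (INR m + b) * tricomi_coeff b n (S m)
  = - (INR n - INR m) * tricomi_coeff b n m.
Proof.
intros H; unfold tricomi_coeff.
rewrite pascal_step3 by assumption.
replace (n - m)%nat with (1 + (n - S m))%nat by lia.
rewrite (pochhammer_add _ 1).
replace (INR (1 + (n - S m))) with (INR n - INR m) by (rewrite <- minus_INR by lia; f_equal; lia).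
rewrite S_INR; simpl.
replace (b + INR m + 1) with (b + (INR m + 1)) by ring.
assert (0 <= INR m) by apply pos_INR.
field; lra.
Qed.

(** The exponent map [e] serves both derivatives: the identity for the first, [pred] for the
    second. *)
Lemma is_derive_sum_pow (c : nat -> R) (e : nat -> nat) (n : nat) (t : R) :
  is_derive (fun t => sum_f_R0 (fun m => c m * t ^ e m) n) t
    (sum_f_R0 (fun m => c m * INR (e m) * t ^ pred (e m)) n).
Proof.
assert (D : forall m, is_derive (fun t => c m * t ^ e m) t
                        (c m * INR (e m) * t ^ pred (e m))).
{ intros m; auto_derive; [trivial | ring]. }
induction n as [| n IH]; [apply D | ].
simpl; apply (is_derive_plus (fun t => sum_f_R0 (fun m => c m * t ^ e m) n)
                             (fun t => c (S n) * t ^ e (S n))); [exact IH | apply D].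
Qed.

(** The recurrence cancels every power below the top one, so truncation at degree [k] leaves one
    residual term; its factor [INR n - INR k] vanishes at [k = n]. *)
Lemma tricomi_poly_kummer_partial (b : R) (n k : nat) (t : R) :
  (k <= n)%nat ->
  let c := tricomi_coeff b n in
  t * sum_f_R0 (fun m => c m * INR m * INR (pred m) * t ^ pred (pred m)) k
  + (b - t) * sum_f_R0 (fun m => c m * INR m * t ^ pred m) k
  + INR n * sum_f_R0 (fun m => c m * t ^ m) k
  = (INR n - INR k) * c k * t ^ k.
Proof.
intros Hk c; induction k as [| k IH]; [simpl; ring | ].
specialize (IH ltac:(lia)).
assert (Hc := tricomi_coeff_succ b n k ltac:(lia)); fold c in Hc.
(* At [k = 0], where [pred 0 = 0], the factor [INR k] makes both sides zero. *)
assert (Hp : t * (INR k * t ^ pred k) = INR k * t ^ k) by (destruct k; simpl; ring).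
rewrite !tech5; cbn [pred].
transitivity ((INR n - INR k) * c k * t ^ k
  + (c (S k) * INR (S k) * (t * (INR k * t ^ pred k))
     + (b - t) * (c (S k) * INR (S k) * t ^ k) + INR n * (c (S k) * t ^ S k))).
{ rewrite <- IH; ring. }
rewrite Hp; rewrite <- (Ropp_involutive (INR n - INR k)) at 1.
replace (- - (INR n - INR k) * c k * t ^ k)
  with (- (INR (S k) * (INR k + b) * c (S k)) * t ^ k) by (rewrite Hc; ring).
simpl (t ^ S k); ring.
Qed.

Lemma is_lim_poly_lead (c : nat -> R) (n : nat) :
  is_lim (fun t => sum_f_R0 (fun m => c m * t ^ m) n / t ^ n) p_infty (c n).
Proof.
induction n as [| n IH].
- apply (is_lim_ext (fun _ => c 0%nat)); [intros t; simpl; field | apply is_lim_const].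
- apply (is_lim_ext_loc
    (fun t => sum_f_R0 (fun m => c m * t ^ m) n / t ^ n * / t + c (S n))).
  + exists 0; intros t Ht; rewrite tech5; simpl.
    field; split; [apply pow_nonzero | ]; lra.
  + replace (Finite (c (S n))) with (Finite (c n * 0 + c (S n))) by (f_equal; ring).
    apply is_lim_plus'; [ | apply is_lim_const].
    apply (is_lim_mult _ _ _ (c n) 0); [exact IH | | exact I].
    apply (is_lim_inv (fun t => t) p_infty p_infty); [apply is_lim_id | discriminate].
Qed.

Lemma is_tricomiU_poly (b : R) (n : nat) :
  is_tricomiU (- INR n) b (tricomi_poly b n).
Proof.
pose (c := tricomi_coeff b n).
assert (D1 : forall t, is_derive (tricomi_poly b n) t
                         (sum_f_R0 (fun m => c m * INR m * t ^ pred m) n))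
  by (intros t; apply (is_derive_sum_pow c (fun m => m))).
assert (D2 : forall t, is_derive (Derive (tricomi_poly b n)) t
  (sum_f_R0 (fun m => c m * INR m * INR (pred m) * t ^ pred (pred m)) n)).
{ intros t.
  apply (is_derive_ext (fun t => sum_f_R0 (fun m => c m * INR m * t ^ pred m) n)).
  - intros s; symmetry; apply is_derive_unique, D1.
  - apply (is_derive_sum_pow (fun m => c m * INR m) pred). }
split.
- intros t Ht; split; [eexists; apply D1 | split; [eexists; apply D2 | ]].
  rewrite (is_derive_unique _ _ _ (D1 t)).
  change (Derive_n (tricomi_poly b n) 2 t) with (Derive (Derive (tricomi_poly b n)) t).
  rewrite (is_derive_unique _ _ _ (D2 t)).
  assert (H := tricomi_poly_kummer_partial b n n t (le_n n)); cbv zeta in H; fold c in H.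
  unfold tricomi_poly; fold c; lra.
- apply (is_lim_ext_loc (fun t => tricomi_poly b n t / t ^ n)).
  + exists 0; intros t Ht; rewrite Ropp_involutive, Rpower_pow by assumption; reflexivity.
  (* The leading coefficient is [(-1) ^ n * (-1) ^ n = 1], which is the purpose of the outer
     sign. *)
  + replace (Finite 1) with (Finite (c n)); [apply is_lim_poly_lead | ].
    f_equal; unfold c, tricomi_coeff.
    rewrite Nat.sub_diag; simpl (pochhammer _ 0).
    unfold Binomial.C; rewrite Nat.sub_diag; simpl (INR (Factorial.fact 0)).
    replace ((-1) ^ n * (INR (Factorial.fact n) / (INR (Factorial.fact n) * 1) * (-1) ^ n * 1))
      with ((-1) ^ n * (-1) ^ n) by (field; apply INR_fact_neq_0).
    rewrite <- Rpow_mult_distr.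
    replace (-1 * -1) with 1 by ring; apply pow1.
Qed.

(** The polynomial witnesses existence, so the chosen function satisfies its specification;
    uniqueness then identifies the two. *)
Lemma tricomiU_poly (b : R) (n : nat) (t : R) :
  0 < t -> tricomiU (- INR n) b t = tricomi_poly b n t.
Proof.
intros Ht; apply (is_tricomiU_unique (- INR n) b); [ | apply is_tricomiU_poly | exact Ht].
apply (epsilon_spec (inhabits (fun _ : R => 0)) (is_tricomiU (- INR n) b)).
eexists; apply is_tricomiU_poly.
Qed.

(** * Improper integrals and the upper incomplete gamma function *)

Lemma is_RInt_gen_at_point_p_infty (f F : R -> R) (a l : R) :
  (forall b, a <= b -> is_RInt f a b (F b)) -> is_lim F p_infty l ->
  is_RInt_gen f (at_point a) (Rbar_locally p_infty) l.
Proof.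
intros HF Hl P HP.
destruct (Hl P HP) as [M HM].
apply (Filter_prod _ _ _ (fun y => y = a) (fun y => Rmax M a < y)).
- reflexivity.
- exists (Rmax M a); auto.
- intros y b -> Hb; exists (F b); simpl.
  assert (M1 := Rmax_l M a); assert (M2 := Rmax_r M a).
  split; [apply HF; lra | apply HM; lra].
Qed.

Lemma is_lim_nondecreasing_bounded (F : R -> R) (a K : R) :
  (forall s t, a <= s <= t -> F s <= F t) -> (forall t, a <= t -> F t <= K) ->
  exists l : R, is_lim F p_infty l.
Proof.
intros Hm HK.
destruct (completeness (fun y => exists t, a <= t /\ y = F t)) as [l [Hub Hlub]].
- exists K; intros y [t [Ht ->]]; auto.
- exists (F a), a; split; [lra | reflexivity].
- exists l; apply is_lim_spec; intros eps; simpl.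
  assert (Hs : exists s, a <= s /\ l - eps < F s).
  { apply Classical_Prop.NNPP; intros H.
    assert (l <= l - eps); [ | assert (He := cond_pos eps); lra].
    apply Hlub; intros y [t [Ht ->]]; apply Rnot_lt_le; intros H'.
    apply H; exists t; auto. }
  destruct Hs as [s [Hs Hls]]; exists s; intros t Ht.
  assert (H1 := Hm s t ltac:(lra)).
  assert (H2 : F t <= l) by (apply Hub; exists t; split; [lra | reflexivity]).
  apply Rabs_lt_between; assert (He := cond_pos eps); lra.
Qed.

Lemma continuous_gamma_integrand (nu t : R) :
  0 < t -> continuous (fun t => Rpower t (nu - 1) * exp (- t)) t.
Proof.
intros Ht; apply (ex_derive_continuous (fun t => Rpower t (nu - 1) * exp (- t))).
unfold Rpower; auto_derive; lra.
Qed.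

Lemma ex_RInt_gamma_integrand (nu a b : R) :
  0 < a -> 0 < b -> ex_RInt (fun t => Rpower t (nu - 1) * exp (- t)) a b.
Proof.
intros Ha Hb; apply (ex_RInt_continuous (fun t => Rpower t (nu - 1) * exp (- t))).
intros t [Ht _]; apply continuous_gamma_integrand.
apply Rlt_le_trans with (2 := Ht); apply Rmin_glb_lt; assumption.
Qed.

(** Convergence must be proved before the value of [RInt_gen] means anything. The integrand is
    nonnegative, so its integrals increase. Bounding the power by [M * exp (t / 2)] leaves
    [M * exp (- t / 2)], whose integral from [z > 0] is at most [2 * M]. *)
Lemma is_lim_upper_gamma (nu z : R) :
  0 < z ->
  is_lim (RInt (fun t => Rpower t (nu - 1) * exp (- t)) z) p_infty (upper_gamma nu z).
Proof.
intros Hz; set (f := fun t => Rpower t (nu - 1) * exp (- t)).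
assert (Hpos : forall t, 0 <= f t)
  by (intros t; apply Rmult_le_pos; apply Rlt_le, exp_pos).
destruct (Rpower_le_exp (nu - 1) (1 / 2) z ltac:(lra) Hz) as [M [HM BM]].
destruct (is_lim_nondecreasing_bounded (RInt f z) z (2 * M)) as [l Hl].
- intros s t Hst.
  assert (H := RInt_Chasles f z s t (ex_RInt_gamma_integrand nu z s Hz ltac:(lra))
                 (ex_RInt_gamma_integrand nu s t ltac:(lra) ltac:(lra))).
  assert (H0 : 0 <= RInt f s t)
    by (apply RInt_ge_0; [lra | apply ex_RInt_gamma_integrand; lra | auto]).
  rewrite <- H; unfold plus; simpl; lra.
- intros t Ht.
  assert (Hi : is_RInt (fun s => M * exp (- s / 2)) z t
                 (minus (-2 * M * exp (- t / 2)) (-2 * M * exp (- z / 2)))).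
  { apply (is_RInt_derive (fun s => -2 * M * exp (- s / 2))).
    - intros s _; auto_derive; [trivial | unfold Rdiv; field].
    - intros s _; apply (ex_derive_continuous (fun s => M * exp (- s / 2))).
      auto_derive; trivial. }
  apply Rle_trans with (RInt (fun s => M * exp (- s / 2)) z t).
  + apply RInt_le; [lra | apply ex_RInt_gamma_integrand; lra | eexists; exact Hi | ].
    intros s Hs; unfold f.
    apply Rle_trans with (M * exp (1 / 2 * s) * exp (- s)).
    * apply Rmult_le_compat_r; [apply Rlt_le, exp_pos | apply BM; lra].
    * rewrite Rmult_assoc, <- exp_plus; apply Req_le; do 2 f_equal; field.
  + rewrite (is_RInt_unique _ _ _ _ Hi); unfold minus, plus, opp; simpl.
    assert (0 < exp (- t / 2)) by apply exp_pos.
    assert (exp (- z / 2) <= 1) by (rewrite <- exp_0; apply exp_le; lra).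
    nra.
- replace (upper_gamma nu z) with l; [exact Hl | symmetry].
  apply (is_RInt_gen_unique f).
  apply (is_RInt_gen_at_point_p_infty f (RInt f z)); [ | exact Hl].
  intros b Hb; apply (RInt_correct f), ex_RInt_gamma_integrand; lra.
Qed.

(** Substitute [t = 2 * s]: the power and the differential together contribute [2 ^ nu]. *)
Lemma is_RInt_gen_upper_gamma_half (nu x : R) :
  0 < x ->
  is_RInt_gen (fun t => Rpower t (nu - 1) * exp (- t / 2))
    (at_point x) (Rbar_locally p_infty) (Rpower 2 nu * upper_gamma nu (x / 2)).
Proof.
intros Hx; pose (f := fun t => Rpower t (nu - 1) * exp (- t)).
apply is_RInt_gen_at_point_p_infty
  with (fun b => Rpower 2 nu * RInt f (x / 2) (b / 2)).
- intros b Hb.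
  apply is_RInt_ext with
    (fun t => scal (Rpower 2 nu) (scal (/ 2) (f (/ 2 * t + 0)))).
  + intros t [Ht _]; rewrite Rmin_left in Ht by lra.
    unfold scal; simpl; unfold mult; simpl; unfold f.
    replace (/ 2 * t + 0) with (t / 2) by field.
    replace (- (t / 2)) with (- t / 2) by field.
    assert (E : Rpower 2 nu * / 2 * Rpower (t / 2) (nu - 1) = Rpower t (nu - 1)).
    { replace (Rpower t (nu - 1)) with (Rpower (2 * (t / 2)) (nu - 1)) by (f_equal; field).
      rewrite <- (Rpower_mult_distr 2 (t / 2)) by lra; f_equal.
      unfold Rminus; rewrite Rpower_plus, Rpower_Ropp, Rpower_1 by lra; reflexivity. }
    rewrite <- E; ring.
  + apply (is_RInt_scal (fun t => scal (/ 2) (f (/ 2 * t + 0)))).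
    apply (is_RInt_comp_lin f (/ 2) 0 x b (RInt f (x / 2) (b / 2))).
    replace (/ 2 * x + 0) with (x / 2) by field.
    replace (/ 2 * b + 0) with (b / 2) by field.
    apply (RInt_correct f), ex_RInt_gamma_integrand; lra.
- apply (is_lim_scal_l (fun b => RInt f (x / 2) (b / 2)) _ p_infty (upper_gamma nu (x / 2))).
  intros P HP; destruct (is_lim_upper_gamma nu (x / 2) ltac:(lra) P HP) as [M HM].
  exists (2 * M); intros b Hb; apply HM; lra.
Qed.

Lemma is_RInt_gen_sum_f_R0 (Fa Fb : (R -> Prop) -> Prop) (f : nat -> R -> R)
    (c l : nat -> R) (n : nat) :
  Filter Fa -> Filter Fb ->
  (forall m, is_RInt_gen (f m) Fa Fb (l m)) ->
  is_RInt_gen (fun t => sum_f_R0 (fun m => c m * f m t) n) Fa Fb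
    (sum_f_R0 (fun m => c m * l m) n).
Proof.
intros FFa FFb Hf.
assert (Hs : forall m, is_RInt_gen (fun t => c m * f m t) Fa Fb (c m * l m))
  by (intros m; apply (is_RInt_gen_scal (f m) (c m) (l m)), Hf).
induction n as [| n IH]; [apply Hs | ].
simpl; apply (is_RInt_gen_plus (fun t => sum_f_R0 (fun m => c m * f m t) n)
                               (fun t => c (S n) * f (S n) t)); [exact IH | apply Hs].
Qed.

(** * Termwise integration and the final formula *)

Lemma wi_upper_gamma (x : R) (n : nat) (kappa : R) :
  0 < x ->
  wi (kappa + INR n) (kappa - 1 / 2) x =
  sum_f_R0 (fun m => tricomi_coeff (2 * kappa) n m
    * (Rpower 2 (kappa + INR m) * upper_gamma (kappa + INR m) (x / 2))) n.
Proof.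
intros Hx.
apply (is_RInt_gen_unique (fun t => whittakerW (kappa + INR n) (kappa - 1 / 2) t / t)).
apply is_RInt_gen_ext with
  (fun t => sum_f_R0 (fun m => tricomi_coeff (2 * kappa) n m
              * (Rpower t (kappa + INR m - 1) * exp (- t / 2))) n).
(* The integrands need to agree only beyond [x > 0], where [tricomiU] is determined. *)
- apply (Filter_prod _ _ _ (fun y => y = x) (fun y => x < y)); [reflexivity | exists x; auto | ].
  intros y b -> Hb t [Ht _]; simpl in Ht; rewrite Rmin_left in Ht by lra.
  match goal with |- ?l = ?r => change (l = r :> R) end; unfold whittakerW.
  (* The choice [mu = kappa - 1 / 2] turns the parameters of U into [- n] and [2 * kappa], and the
     prefactor into [t ^ kappa]. *)
  replace (1 / 2 + (kappa - 1 / 2) - (kappa + INR n)) with (- INR n) by field.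
  replace (1 + 2 * (kappa - 1 / 2)) with (2 * kappa) by field.
  replace (kappa - 1 / 2 + 1 / 2) with kappa by field.
  rewrite tricomiU_poly by lra.
  transitivity (exp (- t / 2) * Rpower t kappa * / t * tricomi_poly (2 * kappa) n t);
    [ | unfold Rdiv; ring].
  unfold tricomi_poly; rewrite scal_sum; apply sum_eq; intros m _.
  replace (kappa + INR m - 1) with (kappa + INR m + - (1)) by ring.
  rewrite !Rpower_plus, Rpower_Ropp, Rpower_1, Rpower_pow by lra; unfold Rdiv; ring.
- apply (is_RInt_gen_sum_f_R0 _ _ (fun m t => Rpower t (kappa + INR m - 1) * exp (- t / 2))
           _ (fun m => Rpower 2 (kappa + INR m) * upper_gamma (kappa + INR m) (x / 2)));
    try typeclasses eauto.
  intros m; apply is_RInt_gen_upper_gamma_half; assumption.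
Qed.

Theorem theorem34 :
  forall (x : R) (n : nat) (kappa : R),
    0 < x ->
    ((~ exists j : nat, 2 * kappa = - INR j) ->
       wi (kappa + INR n) (kappa - 1 / 2) x =
       (-1) ^ n * pochhammer (2 * kappa) n * Rpower 2 kappa *
       sum_f_R0 (fun m =>
         Binomial.C n m * ((-2) ^ m / pochhammer (2 * kappa) m)
           * upper_gamma (kappa + INR m) (x / 2)) n)
    /\
    ((exists j : nat, 2 * kappa = - INR j) ->
       wi (kappa + INR n) (kappa - 1 / 2) x =
       (-1) ^ n * Rpower 2 kappa *
       sum_f_R0 (fun m =>
         Binomial.C n m * (-2) ^ m * pochhammer (2 * kappa + INR m) (n - m)
           * upper_gamma (kappa + INR m) (x / 2)) n).
Proof.
intros x n kappa Hx; rewrite wi_upper_gamma by assumption.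
(* The sign comes from the coefficient of the polynomial, the factor [2 ^ m] from
   [2 ^ (kappa + m)]. *)
assert (Hm1 : forall m, (-2) ^ m = (-1) ^ m * 2 ^ m)
  by (intros m; rewrite <- Rpow_mult_distr; f_equal; ring).
split; intros Hk; rewrite scal_sum; apply sum_eq; intros m Hm;
  unfold tricomi_coeff; rewrite Rpower_plus, Rpower_pow, Hm1 by lra.
- assert (P0 : pochhammer (2 * kappa) m <> 0)
    by (apply pochhammer_neq_0; intros j Hj; apply Hk; exists j; exact Hj).
  (* Splitting the product after [m] factors lets the nonzero denominator cancel. *)
  replace (pochhammer (2 * kappa) n)
    with (pochhammer (2 * kappa) m * pochhammer (2 * kappa + INR m) (n - m))
    by (rewrite <- pochhammer_add; f_equal; lia).
  field; assumption.
- ring.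
Qed.
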